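(* Let $P^-\subset\mathbb{R}^n$ be an $\mathcal{H}$-polytope with positive volume, let $X^-$ be uniformly distributed on $P^-$, and let $\mu^-$ and $\Sigma^-$ be the mean and covariance of $X^-$. Let $H\in\mathbb{R}^{m\times n}$, let $R\in\mathbb{R}^{m\times m}$ be symmetric positive definite, and let $y\in\mathbb{R}^m$. Let $$K=\Sigma^-H^T\left(H\Sigma^-H^T+R\right)^{-1},$$ $$\widetilde K=\Sigma^-H^T\left(H\Sigma^-H^T+R\left(I_m+\sqrt{I_m+R^{-1}H\Sigma^-H^T}\right)\right)^{-1}.$$ Define the posterior random variable of the Kalmanized convex polytope filter by $X^+=\mu^++A^+$, where $$\mu^+=\mu^--K(H\mu^--y),\qquad A^+=(I_n-\widetilde K H)(X^--\mu^-).$$ Then $X^+$ is uniformly distributed on the affine transformation of $P^-$ given by $$P^+=(I_n-\widetilde K H)P^-+(\widetilde K-K)H\mu^-+Ky.$$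
   Context: An $\mathcal{H}$-polytope is a bounded set of the form $P(A,b)=\{x\in\mathbb{R}^n: Ax\le b\}$ with $A\in\mathbb{R}^{p\times n}$, $b\in\mathbb{R}^p$ (componentwise inequality). The uniform distribution on a polytope $P$ has density equal to $1/\mathrm{Vol}(P)$ on $P$ and $0$ elsewhere. For a matrix $C$ and vector $d$, $CP+d=\{Cx+d:x\in P\}$. The square root $\sqrt{I_m+R^{-1}H\Sigma^-H^T}$ is the principal matrix square root (the matrix is similar to a symmetric positive definite matrix). *)

(* Defs.v *)
From HB Require Import structures.
From mathcomp Require Import all_boot all_order all_algebra.
From mathcomp Require Import all_classical all_reals all_analysis.
From mathcomp Require Import complex.

Set Implicit Arguments.
Unset Strict Implicit.
Unset Printing Implicit Defensive.

Import Order.TTheory GRing.Theory Num.Theory.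
Import numFieldNormedType.Exports.

Local Open Scope classical_set_scope.
Local Open Scope ring_scope.

Definition measure_cV_display : measure_display.
Proof. exact. Qed.

(* As for n.-tuple in the library, 'cV[R]_n carries the sigma-algebra generated
   by the coordinate maps, that is, the Borel sigma-algebra of R^n. *)
Section measurable_cV.
Context {R : realType} {n : nat}.

Let coors : 'I_n -> 'cV[R]_n -> R := fun i x => x i 0.

Let cV_set0 : g_sigma_preimage coors set0.
Proof. exact: sigma_algebra0. Qed.

Let cV_setC A : g_sigma_preimage coors A -> g_sigma_preimage coors (~` A).
Proof. exact: sigma_algebraC. Qed.

Let cV_bigcup (F : _^nat) : (forall i, g_sigma_preimage coors (F i)) ->
  g_sigma_preimage coors (\bigcup_i (F i)).
Proof. exact: sigma_algebra_bigcup. Qed.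

HB.instance Definition _ := @isMeasurable.Build measure_cV_display
  'cV[R]_n (g_sigma_preimage coors) cV_set0 cV_setC cV_bigcup.

Lemma measurable_coord (i : 'I_n) :
  measurable_fun [set: 'cV[R]_n] (fun x : 'cV[R]_n => x i 0).
Proof.
move=> _ Y mY; rewrite setTI; apply: sub_sigma_algebra => /=.
rewrite -bigcup_seq/=; exists i => /=; first by rewrite mem_index_enum.
by exists Y => //; rewrite setTI.
Qed.

Lemma measurable_fun_cV d (T : measurableType d) (f : T -> 'cV[R]_n) :
  (forall i, measurable_fun [set: T] (fun t => f t i 0)) ->
  measurable_fun [set: T] f.
Proof.
move=> mf.
suff /= h : preimage_set_system setT f (g_sigma_preimage coors) `<=` measurable.
  by move=> _ A mA; apply: h; exists A.
rewrite -g_sigma_preimage_comp.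
apply: smallest_sub; first exact: sigma_algebra_measurable.
rewrite -bigcup_seq => A [i _] [B mB <-]; exact: mf.
Qed.

End measurable_cV.

(* Lebesgue measure on R^n, by iterated products: R^0 is a point, of mass 1,
   and R^(1 + n) is identified with R * R^n. *)
Definition cons_cV (R : realType) (n : nat) (p : measurableTypeR R * 'cV[R]_n) :
  'cV[R]_n.+1 := col_mx (p.1%:M : 'cV[R]_1) p.2.

Fixpoint lebesgue_cV (R : realType) (n : nat) : set 'cV[R]_n -> \bar R :=
  if n is n'.+1 then
    pushforward (lebesgue_measure \x lebesgue_cV (n := n'))%E (@cons_cV R n')
  else \d_ (0 : 'cV[R]_0).

Lemma measurable_cons_cV (R : realType) n :
  measurable_fun [set: measurableTypeR R * 'cV[R]_n] (@cons_cV R n).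
Proof.
apply: measurable_fun_cV => i; rewrite /cons_cV.
have [j ->|j ->] := split_ordP (i : 'I_(1 + n)).
  rewrite [X in measurable_fun _ X](_ : _ = fst)//; apply/funext => x /=.
  by rewrite (@col_mxEu _ 1 n) ord1 mxE eqxx mulr1n.
rewrite [X in measurable_fun _ X](_ : _ = (fun x : 'cV[R]_n => x j 0) \o snd).
  by apply: measurableT_comp => //; exact: measurable_coord.
by apply/funext => x /=; rewrite (@col_mxEd _ 1 n).
Qed.

Section lebesgue_cV_step.
Context {R : realType} {n : nat} (m : {sigma_finite_measure set 'cV[R]_n -> \bar R}).

Definition lebesgue_cV_step := pushforward (lebesgue_measure \x m)%E (@cons_cV R n).
Local Notation step := lebesgue_cV_step.

Let cons_cV_measurable := @measurable_cons_cV R n.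

Let step0 : step set0 = 0%E.
Proof. by rewrite /step /pushforward preimage_set0 measure0. Qed.

Let step_ge0 A : (0 <= step A)%E.
Proof. exact: measure_ge0. Qed.

Let step_sigma_additive : semi_sigma_additive step.
Proof.
by rewrite /step; exact: measure_semi_sigma_additive.
Qed.

Let step_sigma_finite : sigma_finite setT step.
Proof.
have /sigma_finiteP[F [TF ndF Foo]] :=
  @sigma_finiteT _ _ _ (@lebesgue_measure R).
have /sigma_finiteP[G [TG ndG Goo]] := sigma_finiteT m.
pose g (v : 'cV[R]_n.+1) : measurableTypeR R * 'cV[R]_n :=
  (v ord0 0, \col_i v (lift ord0 i) 0).
have consK : cancel (@cons_cV R n) g.
  move=> [x v]; rewrite /g /cons_cV; congr (_, _).
    rewrite (_ : ord0 = lshift n (0 : 'I_1)); last exact/val_inj.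
    by rewrite (@col_mxEu _ 1 n) mxE eqxx mulr1n.
  apply/colP => i; rewrite mxE.
  rewrite (_ : lift ord0 i = rshift 1 i); last exact/val_inj.
  by rewrite (@col_mxEd _ 1 n).
have mg : measurable_fun setT g.
  apply: measurable_fun_pair; first exact: measurable_coord.
  apply: measurable_fun_cV => i.
  rewrite [X in measurable_fun _ X](_ : _ =
    fun v : 'cV[R]_n.+1 => v (lift ord0 i) 0); first exact: measurable_coord.
  by apply/funext => v; rewrite /g /= mxE.
exists (fun k => g @^-1` (F k `*` G k)).
  rewrite -preimage_bigcup -[LHS](preimage_setT g); congr (_ @^-1` _).
  rewrite -setXTT TF TG predeqE => -[x y]; split.
    move=> [/= [i _ Fx] [k _ Gy]]; exists (maxn i k) => //; split.
    - by move: x Fx; exact/subsetPset/ndF/leq_maxl.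
    - by move: y Gy; exact/subsetPset/ndG/leq_maxr.
  by move=> [k _ []/= ? ?]; split; exists k.
move=> k; have [mF Fk] := Foo k; have [mG Gk] := Goo k.
have mFG : measurable (F k `*` G k) by exact: measurableX.
split; first by rewrite -[X in measurable X]setTI; exact: mg.
suff -> : step (g @^-1` (F k `*` G k)) = (lebesgue_measure \x m)%E (F k `*` G k).
  by rewrite product_measure1E// lte_mul_pinfty// ge0_fin_numE.
rewrite /step /= /pushforward -comp_preimage; congr (product_measure1 _ _ _).
by rewrite (_ : g \o @cons_cV R n = id)//; apply/funext => p; exact: consK.
Qed.

HB.instance Definition _ := isMeasure.Build _ _ _ step
  step0 step_ge0 step_sigma_additive.

HB.instance Definition _ := Measure_isSigmaFinite.Build _ _ _ step
  step_sigma_finite.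

End lebesgue_cV_step.

Section lebesgue_cV_measure.
Context {R : realType}.

Let lebesgue_cVE n : exists m : {sigma_finite_measure set 'cV[R]_n -> \bar R},
  @lebesgue_cV R n = m.
Proof.
elim: n => [|n [m E]]; first by exists (\d_ (0 : 'cV[R]_0)).
by exists (lebesgue_cV_step m); rewrite /= E.
Qed.

Variable n : nat.

Let lebesgue_cV0 : @lebesgue_cV R n set0 = 0%E.
Proof. by have [m ->] := lebesgue_cVE n. Qed.

Let lebesgue_cV_ge0 A : (0 <= @lebesgue_cV R n A)%E.
Proof. by have [m ->] := lebesgue_cVE n. Qed.

Let lebesgue_cV_sigma_additive : semi_sigma_additive (@lebesgue_cV R n).
Proof.
by have [m ->] := lebesgue_cVE n; exact: measure_semi_sigma_additive.
Qed.

Let lebesgue_cV_sigma_finite : sigma_finite setT (@lebesgue_cV R n).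
Proof. by have [m ->] := lebesgue_cVE n; exact: sigma_finiteT. Qed.

HB.instance Definition _ := isMeasure.Build _ _ _ (@lebesgue_cV R n)
  lebesgue_cV0 lebesgue_cV_ge0 lebesgue_cV_sigma_additive.

HB.instance Definition _ := Measure_isSigmaFinite.Build _ _ _
  (@lebesgue_cV R n) lebesgue_cV_sigma_finite.

End lebesgue_cV_measure.

Lemma lebesgue_cV_box (R : realType) (n : nat)
    (B : 'I_n -> set (measurableTypeR R)) :
  (forall i, measurable (B i)) ->
  lebesgue_cV [set x : 'cV[R]_n | forall i, B i (x i 0)] =
  (\big[*%E/1%E]_(i < n) lebesgue_measure (B i))%E.
Proof.
elim: n B => [|n IH] B mB.
  by rewrite big_ord0 /= diracE mem_set// => -[].
rewrite big_ord_recl -(IH (fun i => B (lift ord0 i)))// -product_measure1E//.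
  rewrite /= /pushforward; congr (product_measure1 _ _ _).
  have E0 (p : measurableTypeR R * 'cV[R]_n) : cons_cV p ord0 0 = p.1.
    rewrite /cons_cV (_ : ord0 = lshift n (0 : 'I_1)); last exact/val_inj.
    by rewrite (@col_mxEu _ 1 n) mxE eqxx mulr1n.
  have Ei (p : measurableTypeR R * 'cV[R]_n) i : cons_cV p (lift ord0 i) 0 = p.2 i 0.
    rewrite /cons_cV (_ : lift ord0 i = rshift 1 i); last exact/val_inj.
    by rewrite (@col_mxEd _ 1 n).
  apply/seteqP; split=> p /= Bp.
    by split=> [|i]; [rewrite -E0|rewrite -Ei].
  move: Bp => [B0 Bi] i; case: (unliftP ord0 i) => [j|] ->.
    by rewrite Ei.
  by rewrite E0.
have -> : [set x : 'cV[R]_n | forall i, B (lift ord0 i) (x i 0)] =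
    \bigcap_(i in [set: 'I_n])
      ((fun x : 'cV[R]_n => x i 0) @^-1` B (lift ord0 i)).
  by apply/seteqP; split=> x /= Bx i; [move=> _; exact: Bx|exact: (Bx i I)].
apply: fin_bigcap_measurable => // i _.
by rewrite -[X in measurable X]setTI; apply: measurable_coord => //; exact: mB.
Qed.

Definition hpolyhedron (R : realType) (n p : nat) (A : 'M[R]_(p, n))
    (b : 'cV[R]_p) : set 'cV[R]_n :=
  [set x | forall i, (A *m x) i 0 <= b i 0].

Definition hpolytope (R : realType) (n : nat) (S : set 'cV[R]_n) : Prop :=
  bounded_set S /\
  exists (p : nat) (A : 'M[R]_(p, n)) (b : 'cV[R]_p), S = hpolyhedron A b.

Section random_vectors.
Context {d : measure_display} {T : measurableType d} {R : realType} {n : nat}.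
Variable P : probability T R.

Definition mean_cV (X : T -> 'cV[R]_n) : 'cV[R]_n :=
  \col_i fine 'E_P[fun w => X w i 0%R]%E.

Definition covariance_cV (X : T -> 'cV[R]_n) : 'M[R]_n :=
  \matrix_(i, j) fine (covariance P (fun w => X w i 0) (fun w => X w j 0)).

Definition uniform_density (S : set 'cV[R]_n) (x : 'cV[R]_n) : R :=
  if x \in S then (fine (lebesgue_cV S))^-1 else 0.

Definition uniformly_distributed (S : set 'cV[R]_n) (X : T -> 'cV[R]_n) : Prop :=
  [/\ measurable S,
      (0 < lebesgue_cV S < +oo)%E,
      measurable_fun [set: T] X &
      forall B : set 'cV[R]_n, measurable B ->
        P (X @^-1` B) =
        (\int[@lebesgue_cV R n]_(x in B) (uniform_density S x)%:E)%E].

End random_vectors.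

Definition posdefmx (R : realType) (m : nat) (V : 'M[R]_m) : Prop :=
  V^T = V /\ forall x : 'cV[R]_m, x != 0 -> 0 < (x^T *m V *m x) 0 0.

(* The principal square root of A is the square root all of whose complex
   eigenvalues have positive real part. It is unique, and exists as soon as A
   has no eigenvalue in ]-oo, 0]. *)
Definition is_principal_sqrtmx (R : realType) (m : nat) (A S : 'M[R]_m) : Prop :=
  S *m S = A /\
  forall z : complex R, eigenvalue (map_mx (real_complex R) S) z ->
    0 < complex.Re z.

Definition sqrtmx (R : realType) (m : nat) (A : 'M[R]_m) : 'M[R]_m :=
  xget 0 [set S | is_principal_sqrtmx A S].

(* Main.v *)
(* X+ is the image of X- under an affine map with linear part 1 - Kt H, so two
   facts are needed.
   First, an invertible affine map multiplies Lebesgue measure by a positive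
   constant; its value |det| is irrelevant here, and its existence is the
   uniqueness of a translation invariant measure, obtained from Fubini.
   Second, 1 - Kt H is invertible. With G = H Sigma H^T, S^2 = 1 + V^-1 G and
   N = G + V (1 + S), one has N = V S (1 + S) and 1 - H Kt = V (1 + S) N^-1,
   where S and 1 + S are invertible because the eigenvalues of S have positive
   real part; finally, 1 - Kt H is invertible as soon as 1 - H Kt is. *)
Require Import Defs.
From mathcomp Require Import all_boot all_order all_algebra.
From mathcomp Require Import all_classical all_reals all_analysis.
From mathcomp Require Import measurable_realfun ess_sup_inf ring complex.

Set Implicit Arguments.
Unset Strict Implicit.
Unset Printing Implicit Defensive.

Import Order.TTheory GRing.Theory Num.Theory.
Import numFieldNormedType.Exports.

Local Open Scope classical_set_scope.
Local Open Scope ring_scope.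

(** * Invertibility of the linear part of the update *)

Section invertible_matrices.
Context {R : realType}.

(** The inverse is suggested by the geometric series: [1 + A C B] with [C = (1 - B A)^-1]. A right
    inverse suffices, the matrix being square. *)
Lemma unitmx_1BmulC (n m : nat) (A : 'M[R]_(n, m)) (B : 'M[R]_(m, n)) :
  1%:M - B *m A \in unitmx -> 1%:M - A *m B \in unitmx.
Proof.
move=> u; set C := invmx (1%:M - B *m A).
suff /mulmx1_unit[] : (1%:M - A *m B) *m (1%:M + A *m C *m B) = 1%:M by [].
have e : C = 1%:M + B *m A *m C by rewrite -(mulmxV u) -/C mulmxBl mul1mx subrK.
rewrite mulmxBl mul1mx mulmxDr mulmx1 {1}e mulmxDr mulmx1 mulmxDl !mulmxA.
by rewrite addrK.
Qed.

Lemma posdefmx_unit (m : nat) (V : 'M[R]_m) : posdefmx V -> V \in unitmx.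
Proof.
move=> [_ Vpos]; rewrite unitmxE unitfE; apply/negP => /det0P[v v0 vV].
have := Vpos v^T; rewrite trmx_eq0 => /(_ v0).
by rewrite trmxK vV mul0mx mxE ltxx.
Qed.

Lemma posdefmxD (m : nat) (G V : 'M[R]_m) :
  G^T = G -> (forall x : 'cV[R]_m, 0 <= (x^T *m G *m x) 0 0) ->
  posdefmx V -> posdefmx (G + V).
Proof.
move=> GT G0 [VT V0]; split; first by rewrite linearD/= GT VT.
by move=> x x0; rewrite mulmxDr mulmxDl mxE ltr_wpDl// V0.
Qed.

(** Otherwise [a] would be a real eigenvalue of [S], hence also a complex one, with real part
    [a <= 0]. The cases [a = 0] and [a = -1] give the invertibility of [S] and [1 + S]. *)
Lemma principal_sqrtmxB_unit (m : nat) (A S : 'M[R]_m) (a : R) :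
  is_principal_sqrtmx A S -> a <= 0 -> S - a%:M \in unitmx.
Proof.
move=> [_ Sz] a0; rewrite unitmxE unitfE; apply/negP => /det0P[v v0].
move/eqP; rewrite mulmxBr mul_mx_scalar subr_eq0 => /eqP vS.
have : eigenvalue (map_mx (real_complex R) S) (real_complex R a).
  apply/eigenvalueP; exists (map_mx (real_complex R) v).
    by rewrite -map_mxM vS map_mxZ.
  by rewrite map_mx_eq0.
by move=> /Sz/=; rewrite ltNge a0.
Qed.

(* If V^-1 G + 1 had no principal square root, [sqrtmx] would return 0 and the
   gain would be the Kalman gain, so that its existence is not needed. *)
Lemma kalmanized_unitmx (m : nat) (G V : 'M[R]_m) :
  G^T = G -> (forall x : 'cV[R]_m, 0 <= (x^T *m G *m x) 0 0) -> posdefmx V ->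
  let S := sqrtmx (1%:M + invmx V *m G) in
  let N := G + V *m (1%:M + S) in
  N \in unitmx /\ 1%:M - G *m invmx N \in unitmx.
Proof.
move=> GT G0 Vpos; have uV := posdefmx_unit Vpos => S N.
suff [uN uS] : N \in unitmx /\ 1%:M + S \in unitmx.
  split=> //; rewrite -{1}(mulmxV uN) -mulmxBl /N addrC addKr.
  by rewrite !unitmx_mul uV uS unitmx_inv.
rewrite {}/N {}/S /sqrtmx; case: xgetP => [S _ SS|_]; last first.
  rewrite addr0 mulmx1 unitmx1; split=> //.
  by apply: posdefmx_unit; exact: posdefmxD.
have uS : S \in unitmx.
  rewrite -[S]subr0 -(raddf0 scalar_mx).
  exact: principal_sqrtmxB_unit SS (lexx 0).
have u1S : 1%:M + S \in unitmx.
  rewrite addrC (_ : _ + _ = S - (-1)%:M); last by rewrite raddfN opprK.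
  by apply: principal_sqrtmxB_unit SS _; rewrite oppr_le0 ler01.
split=> //; suff -> : G + V *m (1%:M + S) = V *m (S *m (1%:M + S)).
  by rewrite !unitmx_mul uV uS.
have [SSE _] := SS.
rewrite [S *m _]mulmxDr mulmx1 SSE addrCA addrA !mulmxDr mulmxA mulmxV//.
by rewrite mul1mx addrC.
Qed.

End invertible_matrices.

(** * Lebesgue measure under translations and invertible linear maps *)

Lemma measurable_preimage_setT d1 d2 (T1 : measurableType d1)
    (T2 : measurableType d2) (f : T1 -> T2) (A : set T2) :
  measurable_fun setT f -> measurable A -> measurable (f @^-1` A).
Proof. by move=> mf mA; rewrite -[X in measurable X]setTI; exact: mf. Qed.

(** The translated measure gives each interval []u, v]] its length, and this characterizes Lebesgue
    measure. *)
Lemma lebesgue_measureD (R : realType) (a : R) (A : set (measurableTypeR R)) :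
  measurable A ->
  lebesgue_measure ((fun x : measurableTypeR R => x + a) @^-1` A) =
  lebesgue_measure A.
Proof.
have ma : measurable_fun setT
    ((fun x => x + a) : measurableTypeR R -> measurableTypeR R).
  exact: measurable_funD.
move=> mA; apply/esym.
apply: (lebesgue_measure_unique (mu := pushforward lebesgue_measure
  ((fun x => x + a) : measurableTypeR R -> measurableTypeR R))) => //.
move=> _ [[u v]] _ <- /=; rewrite /pushforward.
rewrite (_ : _ @^-1` _ = `]u - a, v - a]%classic); last first.
  by apply/seteqP; split => x /=; rewrite !in_itv/= ltrBlDr lerBrDr.
by rewrite !lebesgue_measure_itv/= !lte_fin ltrD2r -!EFinD opprB addrA subrK.
Qed.

Section lebesgue_cV_affine.
Context {R : realType}.

Lemma measurable_addcV d (T : measurableType d) n (f g : T -> 'cV[R]_n) :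
  measurable_fun setT f -> measurable_fun setT g ->
  measurable_fun setT (fun x => f x + g x).
Proof.
move=> mf mg; apply: measurable_fun_cV => i.
under eq_fun do rewrite mxE.
by apply: measurable_funD; apply: (measurableT_comp (measurable_coord i)).
Qed.

Lemma measurable_mulcV d (T : measurableType d) n m (L : 'M[R]_(m, n))
    (f : T -> 'cV[R]_n) :
  measurable_fun setT f -> measurable_fun setT (fun x => L *m f x).
Proof.
move=> mf; apply: measurable_fun_cV => i.
under eq_fun do rewrite mxE.
apply: measurable_sum => j; apply: measurable_funM => //.
exact: (measurableT_comp (measurable_coord j)).
Qed.

Lemma measurable_affine_cV n m (L : 'M[R]_(m, n)) (c : 'cV[R]_m) :
  measurable_fun setT (fun x : 'cV[R]_n => L *m x + c).
Proof. by apply: measurable_addcV => //; exact: measurable_mulcV. Qed.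

Lemma cons_cVD n (p q : R * 'cV[R]_n) :
  cons_cV p + cons_cV q = cons_cV (p.1 + q.1, p.2 + q.2).
Proof.
by rewrite /cons_cV/= raddfD; exact: (@add_col_mx _ 1 n 1).
Qed.

(** By induction on the dimension: the first coordinate and the others are translated separately, so
    the translated product measure has the same values on rectangles and uniqueness of the product
    measure applies. *)
Lemma lebesgue_cVD n (a : 'cV[R]_n) (A : set 'cV[R]_n) : measurable A ->
  lebesgue_cV ((fun x => x + a) @^-1` A) = lebesgue_cV A.
Proof.
elim: n a A => [|n IH] a A mA.
  by congr lebesgue_cV; apply/seteqP; split=> x /=; rewrite (flatmx0 (x + a)) (flatmx0 x).
have [a1 [a2 ->]] : exists a1 a2, a = cons_cV (a1, a2).
  exists (a ord0 0), (dsubmx (a : 'cV[R]_(1 + n))).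
  apply: etrans (esym (@vsubmxK _ 1 n 1 a)) _; congr (col_mx _ _).
  apply/matrixP => i j; rewrite !mxE !ord1 eqxx mulr1n; congr (a _ _).
  exact/val_inj.
pose t (p : measurableTypeR R * 'cV[R]_n) : measurableTypeR R * 'cV[R]_n :=
  (p.1 + a1, p.2 + a2).
have mt : measurable_fun setT t.
  apply: measurable_fun_pair; first exact: measurable_funD.
  exact: measurable_addcV.
rewrite /= /pushforward.
rewrite (_ : cons_cV (n := _) @^-1` (_ @^-1` A) = t @^-1` (@cons_cV R n @^-1` A)).
  apply/esym; apply: (product_measure_unique (m' := pushforward
    (lebesgue_measure \x lebesgue_cV (n := n))%E t)) => [B C mB mC|].
    transitivity ((lebesgue_measure \x lebesgue_cV (n := n))%E
      (((fun x : measurableTypeR R => x + a1) @^-1` B) `*`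
       ((fun x => x + a2) @^-1` C))) => //.
    rewrite product_measure1E.
    - by congr (_ * _)%E; [exact: lebesgue_measureD|exact: IH].
    - apply: measurable_preimage_setT => //.
      by apply: (measurable_funD (f := id) (g := cst a1)).
    - by apply: measurable_preimage_setT => //; exact: measurable_addcV.
  by apply: measurable_preimage_setT => //; exact: measurable_cons_cV.
by apply/seteqP; split => p /=; rewrite cons_cVD.
Qed.

Lemma measurable_shear n (C D : set 'cV[R]_n) (f : 'cV[R]_n -> 'cV[R]_n) :
  measurable_fun setT f -> measurable C -> measurable D ->
  measurable [set p : 'cV[R]_n * 'cV[R]_n | C p.1 /\ D (p.2 + f p.1)].
Proof.
move=> mf mC mD.
apply: (measurableI (fst @^-1` C) ((fun p => p.2 + f p.1) @^-1` D)).
  by apply: measurable_preimage_setT.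
apply: measurable_preimage_setT => //; apply: measurable_addcV => //.
exact: measurableT_comp.
Qed.

(** The section at [x] is empty or the translate of [D] by [- f x], so it has the same measure as
    the section of [C x D]. *)
Lemma lebesgue_cV_shear n (C D : set 'cV[R]_n) (f : 'cV[R]_n -> 'cV[R]_n) :
  measurable_fun setT f -> measurable C -> measurable D ->
  ((lebesgue_cV (n := n) \x lebesgue_cV (n := n))
     [set p | C p.1 /\ D (p.2 + f p.1)%R] = lebesgue_cV C * lebesgue_cV D)%E.
Proof.
move=> mf mC mD; rewrite -product_measure1E//; apply: eq_integral => x _ /=.
have [Cx|NCx] := pselect (C x); last first.
  by congr lebesgue_cV; apply/seteqP; split=> y /=; rewrite /xsection/= !inE => -[].
rewrite -[RHS](lebesgue_cVD (f x)); last first.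
  by apply: measurable_xsection; exact: measurableX.
by congr lebesgue_cV; apply/seteqP; split=> y /=; rewrite /xsection/= !inE.
Qed.

(* Both sides are the measure of { (x, y) | - L x \in B, y + L x \in A }, the
   second one after the change of variable x -> x - L^-1 y. *)
Lemma lebesgue_cV_mulmx_cross n (L : 'M[R]_n) (A B : set 'cV[R]_n) :
  L \in unitmx -> measurable A -> measurable B ->
  (lebesgue_cV ((fun x => - (L *m x))%R @^-1` B) * lebesgue_cV A =
   lebesgue_cV ((fun x => L *m x) @^-1` A) * lebesgue_cV B)%E.
Proof.
move=> uL mA mB.
have mL : measurable_fun setT (fun x : 'cV[R]_n => L *m x).
  exact: measurable_mulcV.
have mNL : measurable_fun setT (fun x : 'cV[R]_n => - (L *m x)).
  by under eq_fun do rewrite -mulNmx; exact: measurable_mulcV.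
have mLA := measurable_preimage_setT mL mA.
have mLB := measurable_preimage_setT mNL mB.
rewrite -(lebesgue_cV_shear mL mLB mA) -(lebesgue_cV_shear mNL mLA mB).
(* The change of variable translates [x] by a vector depending on [y], so the measures must be
   computed by sections at fixed [y]. *)
have swap E : measurable E ->
    ((lebesgue_cV (n := n) \x lebesgue_cV (n := n)) E =
     (lebesgue_cV (n := n) \x^ lebesgue_cV (n := n)) E)%E.
  by apply: product_measure_unique => X Y mX mY; exact: product_measure2E.
have mE := measurable_shear mL mLB mA; have mE' := measurable_shear mNL mLA mB.
rewrite !swap//.
apply: eq_integral => y _ /=.
rewrite -[RHS](lebesgue_cVD (invmx L *m y)); last first.
  exact: measurable_ysection.
congr lebesgue_cV; apply/seteqP; split=> x /=; rewrite /ysection/= !inE/=;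
  by rewrite mulmxDr mulKVmx// opprD addrCA subrr addr0 [y + _]addrC => -[].
Qed.

(** Taking for [B] the unit cube, of measure 1, in the preceding identity shows that [k] is the
    measure of the preimage of the cube under [- L]. The translation by [c] changes nothing. *)
Lemma lebesgue_cV_affine n (L : 'M[R]_n) (c : 'cV[R]_n) : L \in unitmx ->
  exists2 k : R, 0 < k & forall A : set 'cV[R]_n, measurable A ->
    lebesgue_cV ((fun x => L *m x + c) @^-1` A) = (k%:E * lebesgue_cV A)%E.
Proof.
move=> uL.
pose Q : set 'cV[R]_n := [set x | forall i, `[0, 1]%classic (x i 0)].
have Q1 : lebesgue_cV Q = 1%E.
  rewrite (lebesgue_cV_box (B := fun=> `[0, 1]%classic))//.
  rewrite big1// => i _.
  by rewrite lebesgue_measure_itv/= lte_fin ltr01 oppr0 adde0.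
have mQ : measurable Q.
  rewrite (_ : Q = \bigcap_(i in [set: 'I_n])
      ((fun x : 'cV[R]_n => x i 0) @^-1` `[0, 1]%classic)).
    apply: fin_bigcap_measurable => // i _.
    by apply: measurable_preimage_setT; first exact: measurable_coord.
  by apply/seteqP; split=> x Qx i; [move=> _; exact: Qx|exact: (Qx i I)].
set k := lebesgue_cV ((fun x => - (L *m x)) @^-1` Q).
have kE A : measurable A ->
    lebesgue_cV ((fun x => L *m x) @^-1` A) = (k * lebesgue_cV A)%E.
  by move=> mA; rewrite lebesgue_cV_mulmx_cross// Q1 mule1.
(* The preimage under [L] of this set is the cube itself. A product equal to 1 forces [k] to be
   neither 0 nor infinite. *)
have kQ : (k * lebesgue_cV ((fun x => invmx L *m x) @^-1` Q) = 1)%E.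
  rewrite -kE -?Q1.
    by congr lebesgue_cV; apply/seteqP; split=> x /=; rewrite mulKmx.
  by apply: measurable_preimage_setT => //; exact: measurable_mulcV.
have k0 : (0 <= k)%E by exact: measure_ge0.
have : k \is a fin_num.
  rewrite ge0_fin_numE// ltNge leye_eq; apply/eqP => ky.
  move: kQ; rewrite ky; set e := lebesgue_cV _.
  have : (0 <= e)%E by exact: measure_ge0.
  rewrite le_eqVlt => /predU1P[<-|e0].
    by rewrite mule0 => -[] /esym/eqP; rewrite oner_eq0.
  by rewrite gt0_mulye.
move=> kfin; exists (fine k).
  rewrite fine_gt0// lt0e k0 andbT ltey_eq kfin/= andbT.
  by apply/eqP => kz; move: kQ; rewrite kz mul0e => -[] /esym/eqP; rewrite oner_eq0.
move=> A mA; rewrite fineK// -[in RHS](lebesgue_cVD c)// -kE//.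
apply: measurable_preimage_setT => //.
by apply: measurable_addcV.
Qed.

End lebesgue_cV_affine.

(** * Covariance matrices of square integrable vectors *)

Section covariance_matrix.
Context {d : measure_display} {T : measurableType d} {R : realType}.
Variable P : probability T R.

Lemma ae_bounded_Lfun (f : T -> R) (M : R) (p : \bar R) : (1 <= p)%E ->
  measurable_fun setT f -> {ae P, forall w, `|f w| <= M} -> f \in Lfun P p.
Proof.
move=> p1 mf fM; have Pfin : P setT \is a fin_num by exact: fin_num_measure.
apply: (Lfun_subset p1 (leey 1%E) Pfin (leey p)).
rewrite inE; apply/andP; split; rewrite inE//=.
rewrite /finite_norm unlock /Lnorm; case: ifPn => // _.
apply: (@le_lt_trans _ _ M%:E); last exact: ltry.
by apply/ess_supP; apply: filterS fM => w /=; rewrite lee_fin.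
Qed.

Lemma sum_Lfun2 I (r : seq I) (f : I -> T -> R) :
  (forall i, f i \in Lfun P 2%:E) -> \sum_(i <- r) f i \in Lfun P 2%:E.
Proof.
have [L0 LD] := Lfun_addr_closed P (lee1n 2).
by move=> fL; elim: r => [|i r IH]; rewrite ?big_nil// big_cons; apply: LD.
Qed.

Lemma covariance_suml I (r : seq I) (f : I -> T -> R) (g : T -> R) :
  (forall i, f i \in Lfun P 2%:E) -> g \in Lfun P 2%:E ->
  covariance P (\sum_(i <- r) f i) g = (\sum_(i <- r) covariance P (f i) g)%E.
Proof.
move=> fL gL; elim: r => [|i r IH].
  by rewrite !big_nil; exact: (covariance_cst_l P 0 g).
rewrite !big_cons -IH; apply: covarianceDl => //.
exact: sum_Lfun2.
Qed.

Lemma covariance_cV_tr n (X : T -> 'cV[R]_n) :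
  (covariance_cV P X)^T = covariance_cV P X.
Proof. by apply/matrixP => i j; rewrite !mxE covarianceC. Qed.

(** The quadratic form at [x] is the variance of the scalar variable [\sum_i x_i X_i]. *)
Lemma covariance_cV_ge0 n (X : T -> 'cV[R]_n) (x : 'cV[R]_n) :
  (forall i, (fun w => X w i 0) \in Lfun P 2%:E) ->
  0 <= (x^T *m covariance_cV P X *m x) 0 0.
Proof.
move=> XL.
pose f i : T -> R := x i 0 \o* (fun w => X w i 0).
have fL i : f i \in Lfun P 2%:E by apply: Lfun_scale => //; rewrite ler1n.
have Pfin : P setT \is a fin_num by exact: fin_num_measure.
have sub1 h : h \in Lfun P 2%:E -> h \in Lfun P 1.
  exact: Lfun_subset12.
have mul1 h1 h2 : h1 \in Lfun P 2%:E -> h2 \in Lfun P 2%:E ->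
  h1 * h2 \in Lfun P 1 by exact: Lfun2_mul_Lfun1.
suff <- : fine (variance P (\sum_i f i)) = (x^T *m covariance_cV P X *m x) 0 0.
  by apply: fine_ge0; exact: variance_ge0.
(* Finiteness lets [fine] commute with the sums and products of covariances. *)
have cfin h1 h2 : h1 \in Lfun P 2%:E -> h2 \in Lfun P 2%:E ->
  covariance P h1 h2 \is a fin_num.
  by move=> L1 L2; apply: covariance_fin_num; [exact: sub1..|exact: mul1].
have sL : \sum_i f i \in Lfun P 2%:E by exact: sum_Lfun2.
rewrite /variance covariance_suml// -sum_fine; last by move=> i _; exact: cfin.
rewrite mxE; apply: eq_bigr => j _.
rewrite covarianceC covariance_suml// -sum_fine; last by move=> i _; exact: cfin.
rewrite mxE big_distrl/=; apply: eq_bigr => i _.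
rewrite /f (covarianceZl _ (sub1 _ (XL i)) (sub1 _ (fL j)))//; last exact: mul1.
rewrite (covarianceZr _ (sub1 _ (XL i)) (sub1 _ (XL j)))//; last exact: mul1.
rewrite !fineM ?fin_numM ?cfin// !mxE mulrA.
by rewrite -mulrA [RHS]mulrAC mulrA.
Qed.

End covariance_matrix.

(** * Uniform distributions: affine images and integrability *)

Section uniform.
Context {d : measure_display} {T : measurableType d} {R : realType} {n : nat}.
Variable P : probability T R.

Lemma integral_uniform_density (S B : set 'cV[R]_n) :
  measurable S -> measurable B ->
  (\int[@lebesgue_cV R n]_(x in B) (uniform_density S x)%:E)%E =
  (((fine (lebesgue_cV S))^-1)%:E * lebesgue_cV (S `&` B))%E.
Proof.
move=> mS mB.
under eq_integral => x _.
  rewrite (_ : (uniform_density S x)%:E =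
    ((fine (lebesgue_cV S))^-1)%:E * (\1_S x)%:E)%E; last first.
    rewrite /uniform_density indicE; case: ifP => _; first by rewrite mule1.
    by rewrite mule0.
  over.
rewrite ge0_integralZl//.
- by rewrite integral_indic// setIC.
- by apply/measurable_EFinP; exact: measurable_indic.
- by rewrite lee_fin invr_ge0 fine_ge0.
Qed.

(** Both [S] and its part [S] meet [f^-1 B] are preimages under [f], so their volumes are [k] times
    those of their images, and [k] cancels in the quotient. *)
Lemma uniformly_distributed_affine (S : set 'cV[R]_n) (X : T -> 'cV[R]_n)
    (L : 'M[R]_n) (c : 'cV[R]_n) :
  L \in unitmx -> uniformly_distributed P S X ->
  uniformly_distributed P [set L *m x + c | x in S] (fun w => L *m X w + c).
Proof.
move=> uL [mS /andP[S0 Soo] mX PX].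
set f := fun x : 'cV[R]_n => L *m x + c.
have mf : measurable_fun setT f by exact: measurable_affine_cV.
pose g := fun x : 'cV[R]_n => invmx L *m (x - c).
have gK : cancel f g by move=> x; rewrite /g /f addrK mulKmx.
have fK : cancel g f by move=> x; rewrite /g /f mulKVmx// subrK.
(* Written as a preimage under the inverse map, the image is seen to be measurable. *)
have imE : [set f x | x in S] = g @^-1` S.
  apply/seteqP; split=> [_ [x Sx <-]|x Sx]; first by rewrite /= gK.
  by exists (g x).
have mg : measurable_fun setT g.
  by apply: measurable_mulcV; apply: measurable_addcV.
have mfS : measurable [set f x | x in S].
  by rewrite imE; exact: measurable_preimage_setT.
have [k k0 kE] := lebesgue_cV_affine c uL.
have preE : f @^-1` [set f x | x in S] = S.
  by rewrite imE; apply/seteqP; split=> x /=; rewrite gK.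
have SE : lebesgue_cV S = (k%:E * lebesgue_cV [set f x | x in S])%E.
  by rewrite -kE// preE.
have fSfin : lebesgue_cV [set f x | x in S] \is a fin_num.
  rewrite ge0_fin_numE// ltNge leye_eq; apply/eqP => fSy.
  by move: Soo; rewrite SE fSy gt0_muley ?lte_fin// ltxx.
split=> //.
- rewrite -ge0_fin_numE// fSfin andbT lt0e measure_ge0 andbT.
  by apply/eqP => fS0; move: S0; rewrite SE fS0 mule0 ltxx.
- by apply: measurable_addcV => //; exact: measurable_mulcV.
- move=> B mB.
  have mfB : measurable (f @^-1` B) by exact: measurable_preimage_setT.
  rewrite (_ : _ @^-1` B = X @^-1` (f @^-1` B))// PX//.
  rewrite !integral_uniform_density// SE.
  have -> : S `&` f @^-1` B = f @^-1` ([set f x | x in S] `&` B).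
    by rewrite preimage_setI preE.
  rewrite kE; last exact: measurableI.
  rewrite fineM// invfM muleA -EFinM; congr (_%:E * _)%E.
  by rewrite mulrAC mulVf ?mul1r// gt_eqF.
Qed.

(** The law of [X] gives [S] mass 1, so each coordinate is almost surely bounded. *)
Lemma uniformly_distributed_Lfun2 (S : set 'cV[R]_n) (X : T -> 'cV[R]_n)
    (i : 'I_n) :
  bounded_set S -> uniformly_distributed P S X ->
  (fun w => X w i 0) \in Lfun P 2%:E.
Proof.
move=> [M [_ SM]] [mS /andP[S0 Soo] mX PX].
(* [bounded_set] provides the bounds strictly above [M] only, whence [M + 1]. *)
apply: (ae_bounded_Lfun (M := M + 1)); first by rewrite lee1n.
  exact: (measurableT_comp (measurable_coord i)).
have mXS : measurable (X @^-1` S) by exact: measurable_preimage_setT.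
exists (~` (X @^-1` S)); split; first exact: measurableC.
  rewrite probability_setC// PX// integral_uniform_density// setIid.
  have Sfin : lebesgue_cV S \is a fin_num by rewrite ge0_fin_numE.
  rewrite -{2}(fineK Sfin) -EFinM mulVf ?subee//.
  by rewrite gt_eqF// fine_gt0// S0.
move=> w /= + XS; apply.
apply: le_trans (SM (M + 1) _ _ XS); last by rewrite ltrDl.
rewrite [leRHS]mx_normrE.
exact: (le_bigmax _ (fun ij : 'I_n * 'I_1 => `|X w ij.1 ij.2|) (i, 0)).
Qed.

End uniform.

(** * The filter update as an affine map *)

Theorem theorem4p1 (R : realType) (d : measure_display) (T : measurableType d)
    (P : probability T R) (n m : nat) (Pm : set 'cV[R]_n) (X : T -> 'cV[R]_n)
    (H : 'M[R]_(m, n)) (V : 'M[R]_m) (y : 'cV[R]_m) :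
  hpolytope Pm ->
  (0 < lebesgue_cV Pm)%E ->
  uniformly_distributed P Pm X ->
  posdefmx V ->
  let mu := mean_cV P X in
  let Sigma := covariance_cV P X in
  let K := Sigma *m H^T *m invmx (H *m Sigma *m H^T + V) in
  let Kt := Sigma *m H^T *m
    invmx (H *m Sigma *m H^T +
           V *m (1%:M + sqrtmx (1%:M + invmx V *m H *m Sigma *m H^T))) in
  let mup := mu - K *m (H *m mu - y) in
  let Ap := fun w => (1%:M - Kt *m H) *m (X w - mu) in
  let Xp := fun w => mup + Ap w in
  let Pp := [set (1%:M - Kt *m H) *m x + ((Kt - K) *m H *m mu + K *m y) | x in Pm] in
  uniformly_distributed P Pp Xp.
Proof.
move=> [bPm _] _ unifX Vpos mu Sigma K Kt mup Ap Xp Pp.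
have XpE : Xp = fun w => (1%:M - Kt *m H) *m X w + ((Kt - K) *m H *m mu + K *m y).
  apply/funext => w; rewrite /Xp /mup /Ap.
  rewrite !mulmxBl !mulmxBr !mul1mx -!mulmxA.
  (* With the matrix products abstracted, what remains is an additive identity, checked
     entrywise. *)
  set a := Kt *m (H *m X w); set b := Kt *m (H *m mu); set e := K *m (H *m mu).
  set z := K *m y; move: (X w) => x; clearbody a b e z.
  apply/matrixP => i j; rewrite !mxE; ring.
rewrite XpE; apply: uniformly_distributed_affine => //.
have G_tr : (H *m Sigma *m H^T)^T = H *m Sigma *m H^T.
  by rewrite !trmx_mul trmxK covariance_cV_tr mulmxA.
have G_ge0 (x : 'cV[R]_m) : 0 <= (x^T *m (H *m Sigma *m H^T) *m x) 0 0.
  (* The form of [H Sigma H^T] at [x] is that of [Sigma] at [H^T x]. *)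
  have := covariance_cV_ge0 (P := P) (X := X) (H^T *m x).
  rewrite trmx_mul trmxK !mulmxA; apply.
  by move=> i; exact: uniformly_distributed_Lfun2 unifX.
have [_] := kalmanized_unitmx G_tr G_ge0 Vpos.
by rewrite !mulmxA => u; apply: unitmx_1BmulC; rewrite !mulmxA.
Qed.
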